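(* Let $\mathcal I=(I_n)_{n\ge 1}$ be an $\mathrm{Inc}$-invariant chain of eventually nonzero edge ideals. Let $r=\mathrm{ind}(\mathcal I)\ge 1$ be its stability index. Then for all $n\ge 4r$ there is an inequality $\operatorname{reg} I_n\le 3$.
   Context: Let $\Bbbk$ be a field, $R_n=\Bbbk[x_1,\ldots,x_n]$ the standard graded polynomial ring, $R=\bigcup_{n\ge 1}R_n$, and $\mathbb N$ the set of positive integers. $\mathrm{Inc}$ is the monoid of strictly increasing functions $\pi:\mathbb N\to\mathbb N$ under composition, acting on $R$ by $\Bbbk$-algebra endomorphisms via $\pi(x_i)=x_{\pi(i)}$. A family $\mathcal I=(I_n)_{n\ge 1}$ of ideals $I_n\subseteq R_n$ is an $\mathrm{Inc}$-invariant chain if $\pi(I_m)\subseteq I_n$ for all $1\le m<n$ and all $\pi\in\mathrm{Inc}$ with $\pi(m)\le n$. For $m\le n$ put $\mathrm{Inc}_{m,n}=\{\pi\in\mathrm{Inc}\mid \pi(m)\le n\}$. The stability index $\mathrm{ind}(\mathcal I)$ is the smallest $r\ge 1$ such that for all $n\ge r$, $I_n$ is the ideal of $R_n$ generated by $\mathrm{Inc}_{r,n}(I_r)=\{\pi(f):\pi\in \mathrm{Inc}_{r,n}, f\in I_r\}$ (such an $r$ always exists). An edge ideal is an ideal of $R_n$ generated by squarefree quadratic monomials. A chain of eventually nonzero edge ideals is one in which each $I_n$ is an edge ideal and $I_n\neq 0$ for all $n\gg 0$. $\operatorname{reg}$ denotes Castelnuovo–Mumford regularity. *)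

(* Defs.v *)
From mathcomp Require Import all_boot all_order all_algebra.
From mathcomp Require Import classical_sets.
From mathcomp Require Import mpoly.

Set Implicit Arguments.
Unset Strict Implicit.
Unset Printing Implicit Defensive.

Import Order.TTheory GRing.Theory Num.Theory.
Local Open Scope ring_scope.

(** R_n = k[x_1, ..., x_n] is [{mpoly k[n]}]; its variables are indexed by
    ['I_n], so x_i is ['X_(i - 1)].  Positive integers are shifted to [nat] in
    the same way: pi : N -> N of the text is here i |-> pi (i + 1) - 1. *)

Definition ideal_gen (A : comNzRingType) (S : set A) : set A :=
  fun f => exists s : seq (A * A),
    (forall c, c \in s -> S c.2) /\ f = \sum_(c <- s) c.1 * c.2.

Definition Inc (pi : nat -> nat) : Prop := {homo pi : i j / (i < j)%N}.

(** Inc_{m,n} for 1 <= m <= n: since the largest index used in R_m is m - 1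
    after the shift, the condition pi(m) <= n reads pi (m - 1) < n. *)
Definition Inc_mn (m n : nat) (pi : nat -> nat) : Prop :=
  Inc pi /\ (pi m.-1 < n)%N.

(** The restriction R_m -> R_n of the k-algebra endomorphism x_i |-> x_{pi(i)}.
    The default value 0 is never reached when [Inc_mn m n pi] holds. *)
Definition inc_act (k : fieldType) (m n : nat) (pi : nat -> nat)
    (f : {mpoly k[m]}) : {mpoly k[n]} :=
  mmap (@mpolyC n k)
    (fun i : 'I_m => if insub (pi i) is Some j then 'X_(j : 'I_n) else 0) f.

(** A family (I_n) is given for all n : nat, but I_0 is never referred to. *)
Definition Inc_invariant (k : fieldType)
    (I : forall n, set {mpoly k[n]}) : Prop :=
  forall m n pi, (0 < m)%N -> (m < n)%N -> Inc_mn m n pi ->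
  forall f, I m f -> I n (inc_act n pi f).

Definition stable_from (k : fieldType)
    (I : forall n, set {mpoly k[n]}) (r : nat) : Prop :=
  forall n, (r <= n)%N ->
  I n = ideal_gen (fun g => exists pi f,
                     [/\ Inc_mn r n pi, I r f & g = inc_act n pi f]).

(** r = ind(I) *)
Definition is_ind (k : fieldType)
    (I : forall n, set {mpoly k[n]}) (r : nat) : Prop :=
  [/\ (0 < r)%N, stable_from I r &
      forall s, (0 < s)%N -> stable_from I s -> (r <= s)%N].

Definition sqfree_quadratic (n : nat) (u : 'X_{1..n}) : Prop :=
  mdeg u = 2%N /\ forall i, (u i <= 1)%N.

(** The zero ideal is an edge ideal (take [S] empty). *)
Definition is_edge_ideal (k : fieldType) (n : nat)
    (J : set {mpoly k[n]}) : Prop :=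
  exists S : set 'X_{1..n},
    (forall u, S u -> sqfree_quadratic u) /\
    J = ideal_gen (fun g => exists2 u, S u & g = 'X_[u]).

Definition nonzero_ideal (k : fieldType) (n : nat)
    (J : set {mpoly k[n]}) : Prop := exists2 f, J f & f != 0.

(** A sequence of graded free modules of finite rank over R_n
      ... -> F_2 -> F_1 -> F_0 -> R_n,   F_i = (+)_(p < rk i) R_n(- shift i p).
    Elements of F_i are row vectors and the maps act by multiplication on the
    right, as in [kermx]: F_{i+1} -> F_i is v |-> v *m dif i, and F_0 -> R_n is
    v |-> v *m aug. *)
Record free_seq (k : fieldType) (n : nat) := FreeSeq {
  rk : nat -> nat;
  shift : forall i, 'I_(rk i) -> nat;
  dif : forall i, 'M[{mpoly k[n]}]_(rk i.+1, rk i);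
  aug : 'cV[{mpoly k[n]}]_(rk 0)
}.

(** All maps are homogeneous of degree 0. *)
Definition graded_seq (k : fieldType) (n : nat) (F : free_seq k n) : Prop :=
  (forall p, aug F p 0 \is (shift p).-homog) /\
  (forall i (p : 'I_(rk F i.+1)) (q : 'I_(rk F i)) u,
     u \in msupp (dif F i p q) -> (mdeg u + shift q)%N = shift p).

(** ... -> F_1 -> F_0 -> J -> 0 is exact. *)
Definition resolves (k : fieldType) (n : nat) (F : free_seq k n)
    (J : set {mpoly k[n]}) : Prop :=
  [/\ forall f, J f <-> exists v : 'rV_(rk F 0), f = (v *m aug F) 0 0,
      forall v : 'rV_(rk F 0),
        v *m aug F = 0 <-> exists w, v = w *m dif F 0
    & forall i (v : 'rV_(rk F i.+1)),
        v *m dif F i = 0 <-> exists w, v = w *m dif F i.+1].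

(** The image of F_{i+1} lies in (x_1, ..., x_n) F_i. *)
Definition minimal_seq (k : fieldType) (n : nat) (F : free_seq k n) : Prop :=
  forall i p q, (dif F i p q)@_0%MM = 0.

Definition minimal_graded_free_resolution (k : fieldType) (n : nat)
    (F : free_seq k n) (J : set {mpoly k[n]}) : Prop :=
  [/\ graded_seq F, resolves F J & minimal_seq F].

(** reg J = d, where reg J is the maximum of the a - i over all summands
    R_n(- a) of F_i in the minimal graded free resolution F of J, equivalently
    over all i and a with Tor_i(J, k)_a != 0.  F is unique up to isomorphism,
    so that at most one d satisfies this; one does as soon as J is a nonzero
    homogeneous ideal. *)
Definition has_reg (k : fieldType) (n : nat)
    (J : set {mpoly k[n]}) (d : int) : Prop :=
  exists F : free_seq k n,
    [/\ minimal_graded_free_resolution F J,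
        forall i (p : 'I_(rk F i)), (shift p)%:Z - i%:Z <= d
      & exists i (p : 'I_(rk F i)), (shift p)%:Z - i%:Z = d].

(* Main.v *)
Require Import Defs.
From HB Require Import structures.
From mathcomp Require Import all_boot all_order all_algebra.
From mathcomp Require Import boolp classical_sets.
From mathcomp Require Import mpoly.
From mathcomp Require Import zify ring.

Import Order.TTheory GRing.Theory Num.Theory.
Local Open Scope ring_scope.

Set Implicit Arguments.
Unset Strict Implicit.
Unset Printing Implicit Defensive.

(** If an ideal I splits as I' + xL with x a variable, I' generated without x
    and I' contained in L = I : x, the mapping cone over the resolutions of I'
    and L gives reg I <= max (reg I', reg L + 1).  For an edge ideal this reads
    reg I(G) <= max (reg I(G - v), reg I(G - N[v]) + 1).

    Number the variables from 0.  By stability the pair a < b is an edge of I_n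
    iff some edge (i, j) of I_r satisfies a >= i, b - a >= j - i and
    n - b >= r - j.  When n >= 4r, one of the two outer conditions is void for
    every pair with b - a < r.  Hence, deleting the vertices v = n - r, .., 0 in
    this order, the remaining graph on the non-neighbours of v only has edges
    between vertices >= r - 1, where the complement is an interval graph and the
    regularity is at most 2.

    A resolution with bounded shifts, built coinductively one syzygy module at a
    time, is made minimal by discarding redundant generators. *)

(** * Graded free modules and regularity *)

Section MonomialSelection.
Variables (k : fieldType) (n : nat).
Local Notation R := {mpoly k[n]}.

Definition msel (P : pred 'X_{1..n}) (f : R) : R :=
  \sum_(m <- msupp f | P m) f@_m *: 'X_[m].

Lemma mcoeff_msel P f m : (msel P f)@_m = if P m then f@_m else 0.
Proof.
rewrite /msel big_mkcond raddf_sum /=.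
case: (boolP (m \in msupp f)) => mf; last first.
  rewrite (memN_msupp_eq0 mf) if_same big_seq big1 // => u uf.
  case: (P u); rewrite ?mcoeff0 // mcoeffZ mcoeffX.
  by case: eqP uf mf => [->->|]; rewrite ?mulr0.
rewrite (bigD1_seq m) ?msupp_uniq //= big1 ?addr0; last first.
  by move=> u um; case: (P u); rewrite ?mcoeff0 // mcoeffZ mcoeffX (negPf um) mulr0.
by case: (P m); rewrite ?mcoeff0 // mcoeffZ mcoeffX eqxx mulr1.
Qed.

Lemma msel_is_linear P : linear (msel P).
Proof.
move=> c f g; apply/mpolyP => m.
rewrite mcoeffD mcoeffZ !mcoeff_msel.
by case: (P m); rewrite ?mulr0 ?addr0 // mcoeffD mcoeffZ.
Qed.

HB.instance Definition _ P :=
  GRing.isLinear.Build k R R _ (msel P) (msel_is_linear P).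

Lemma mselX P m : msel P 'X_[m] = if P m then 'X_[m] else 0.
Proof.
apply/mpolyP => u; rewrite mcoeff_msel mcoeffX.
case: (m =P u) => [->|/eqP mu]; case: (P _) => //; rewrite ?mcoeff0 ?mcoeffX ?eqxx //;
  case: (P _); by rewrite ?mcoeff0 ?mcoeffX ?(negPf mu).
Qed.

Lemma msel_supp P f u : u \in msupp (msel P f) -> P u /\ u \in msupp f.
Proof. by rewrite !mcoeff_msupp mcoeff_msel; case: (P u); rewrite ?eqxx. Qed.

Lemma msel_id (P : pred 'X_{1..n}) f :
  (forall u, u \in msupp f -> P u) -> msel P f = f.
Proof.
move=> h; apply/mpolyP => m; rewrite mcoeff_msel.
by case: (boolP (m \in msupp f)) => [/h ->|/memN_msupp_eq0 ->]; rewrite ?if_same.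
Qed.

(** The case in view is [g] homogeneous of degree b, with [P] selecting degree a and [Q] degree a -
    b; a pair of predicates avoids the subtraction. *)
Lemma msel_mul (P Q : pred 'X_{1..n}) f g :
  (forall u, u \in msupp g -> forall m, P (m + u)%MM = Q m) ->
  msel P (f * g) = msel Q f * g.
Proof.
move=> h; rewrite {1}(mpolyE f) mulr_suml linear_sum /=.
rewrite [msel Q f]/msel mulr_suml [RHS]big_mkcond /=; apply: eq_bigr => m _.
rewrite -!scalerAl linearZ /=.
transitivity (f@_m *: ((if Q m then 'X_[m] else 0) * g)); last first.
  by case: (Q m); rewrite // mul0r scaler0.
congr (_ *: _); rewrite (mpolyE g) !mulr_sumr linear_sum; apply: eq_big_seq => u ug /=.
by rewrite -!scalerAr linearZ /= -mpolyXD mselX (h _ ug); case: (Q m); rewrite ?mpolyXD ?mul0r.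
Qed.

End MonomialSelection.

(** * Graded maps of free modules and the horseshoe lemma *)

Section GradedModules.
Variables (k : fieldType) (n : nat).
Local Notation R := {mpoly k[n]}.

(** A map of degree 0 between graded free modules, acting on row vectors: the entry at p, q is
    homogeneous of degree [s1 p - s2 q], hence zero when this is negative. *)
Definition graded_mx m1 m2 (A : 'M[R]_(m1, m2)) (s1 : 'I_m1 -> nat) (s2 : 'I_m2 -> nat) :=
  forall p q u, u \in msupp (A p q) -> (mdeg u + s2 q)%N = s1 p.

Definition hcomp m (s : 'I_m -> nat) a (v : 'rV[R]_m) : 'rV[R]_m :=
  \row_q msel (fun u => (mdeg u + s q)%N == a) (v 0 q).

Lemma hcomp_mul m1 m2 (A : 'M[R]_(m1, m2)) s1 s2 a (w : 'rV_m1) :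
  graded_mx A s1 s2 -> hcomp s2 a (w *m A) = hcomp s1 a w *m A.
Proof.
move=> gA; apply/rowP => j; rewrite !mxE linear_sum; apply: eq_bigr => i _ /=.
rewrite mxE; apply: msel_mul => u uA m.
by rewrite mdegD -addnA (gA _ _ _ uA).
Qed.

Lemma hcomp_id m (s : 'I_m -> nat) a v :
  graded_mx v (fun _ : 'I_1 => a) s -> hcomp s a v = v.
Proof.
by move=> gv; apply/rowP => j; rewrite mxE msel_id // => u uv; rewrite (gv _ _ _ uv).
Qed.

Lemma graded_hcomp m (s : 'I_m -> nat) a v :
  graded_mx (hcomp s a v) (fun _ : 'I_1 => a) s.
Proof. by move=> p q u; rewrite mxE => /msel_supp[/eqP]. Qed.

Lemma graded_row m1 m2 (A : 'M[R]_(m1, m2)) s1 s2 p :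
  graded_mx A s1 s2 -> graded_mx (row p A) (fun=> s1 p) s2.
Proof. by move=> gA i q u; rewrite mxE => /gA. Qed.

Lemma graded_rows m1 m2 (A : 'M[R]_(m1, m2)) s1 s2 :
  (forall p, graded_mx (row p A) (fun=> s1 p) s2) -> graded_mx A s1 s2.
Proof. by move=> gA p q u uA; apply: (gA p 0 q); rewrite mxE. Qed.

Lemma graded_addS m1 m2 (A : 'M[R]_(m1, m2)) s1 s2 :
  graded_mx A s1 s2 -> graded_mx A (fun p => (s1 p).+1) (fun q => (s2 q).+1).
Proof. by move=> gA p q u /gA <-; rewrite addnS. Qed.

Definition scat m1 m2 (s1 : 'I_m1 -> nat) (s2 : 'I_m2 -> nat) (i : 'I_(m1 + m2)) :=
  match split i with inl j => s1 j | inr j => s2 j end.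

Lemma scat_le m1 m2 (s1 : 'I_m1 -> nat) (s2 : 'I_m2 -> nat) d :
  (forall i, s1 i <= d)%N -> (forall i, s2 i <= d)%N -> forall i, (scat s1 s2 i <= d)%N.
Proof. by move=> h1 h2 i; rewrite /scat; case: split. Qed.

Lemma graded_col_mx m1 m2 m (A : 'M[R]_(m1, m)) (B : 'M[R]_(m2, m)) s1 s2 s :
  graded_mx A s1 s -> graded_mx B s2 s -> graded_mx (col_mx A B) (scat s1 s2) s.
Proof.
move=> gA gB p q u; rewrite mxE /scat; case: split => j; [exact: gA|exact: gB].
Qed.

Lemma graded_row_mx m1 m2 m (A : 'M[R]_(m, m1)) (B : 'M[R]_(m, m2)) s1 s2 s :
  graded_mx A s s1 -> graded_mx B s s2 -> graded_mx (row_mx A B) s (scat s1 s2).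
Proof.
move=> gA gB p q u; rewrite mxE /scat; case: split => j; [exact: gA|exact: gB].
Qed.

Lemma graded_0 m1 m2 (s1 : 'I_m1 -> nat) (s2 : 'I_m2 -> nat) : graded_mx 0 s1 s2.
Proof. by move=> p q u; rewrite mxE msupp0. Qed.

Lemma hcomp_row_mx m1 m2 (s1 : 'I_m1 -> nat) (s2 : 'I_m2 -> nat) a u v :
  hcomp (scat s1 s2) a (row_mx u v) = row_mx (hcomp s1 a u) (hcomp s2 a v).
Proof.
apply/rowP => j; rewrite !mxE /scat.
by case: (split j) => i; rewrite mxE.
Qed.

Definition graded_submod m (s : 'I_m -> nat) (K : 'rV[R]_m -> Prop) :=
  [/\ K 0, forall a u v, K u -> K v -> K (a *: u + v) & forall a v, K v -> K (hcomp s a v)].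

Lemma hcomp0 m (s : 'I_m -> nat) a : hcomp s a 0 = 0.
Proof. by apply/rowP => j; rewrite !mxE linear0. Qed.

Lemma graded_submod_ker m1 m2 (A : 'M[R]_(m1, m2)) s1 s2 :
  graded_mx A s1 s2 -> graded_submod s1 (fun w => w *m A = 0).
Proof.
move=> gA; split=> [|a u v u0 v0|a v v0]; first exact: mul0mx.
  by rewrite mulmxDl -scalemxAl u0 v0 scaler0 addr0.
by rewrite -(hcomp_mul _ _ gA) v0 hcomp0.
Qed.

(** Any lift of a row may be replaced by its homogeneous component in the degree of that row, since
    [A] preserves degrees. *)
Lemma graded_lift m1 m2 m (A : 'M[R]_(m1, m)) (B : 'M[R]_(m2, m)) s1 s2 s :
  graded_mx A s1 s -> graded_mx B s2 s ->
  (forall p, exists w, row p B = w *m A) ->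
  exists2 X : 'M[R]_(m2, m1), graded_mx X s2 s1 & B = X *m A.
Proof.
move=> gA gB h.
have {}h p : exists w, graded_mx w (fun _ : 'I_1 => s2 p) s1 /\ row p B = w *m A.
  have [w wB] := h p; exists (hcomp s1 (s2 p) w); split; first exact: graded_hcomp.
  by rewrite -(hcomp_mul _ _ gA) -wB hcomp_id //; exact: graded_row.
have [f hf] := choice h; exists (\matrix_p f p).
  by apply: graded_rows => p; rewrite rowK; case: (hf p).
by apply/row_matrixP => p; rewrite row_mul rowK; case: (hf p).
Qed.

(** A resolution of [K] by finite free modules, the generators in
    homological degree [i] having degree at most [d + i]. *)
CoInductive regular (d m : nat) (s : 'I_m -> nat) (K : 'rV[R]_m -> Prop) : Prop :=
  Regular m' (s' : 'I_m' -> nat) (A : 'M[R]_(m', m)) of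
    graded_mx A s' s & (forall p, s' p <= d)%N &
    (forall v, K v <-> exists w, v = w *m A) &
    regular d.+1 s' (fun w => w *m A = 0).

(** Confines the guarded corecursion to one place: later arguments only give an invariant [P] that
    survives passing to syzygies. *)
Lemma regular_coind (P : forall (d m : nat), ('I_m -> nat) -> ('rV[R]_m -> Prop) -> Prop) :
  (forall d m s K, P d m s K ->
     exists m' (s' : 'I_m' -> nat) (A : 'M[R]_(m', m)),
       [/\ graded_mx A s' s, (forall p, s' p <= d)%N,
           (forall v, K v <-> exists w, v = w *m A) &
           P d.+1 m' s' (fun w => w *m A = 0)]) ->
  forall d m s K, P d m s K -> regular d s K.
Proof.
move=> h; cofix IH => d m s K /h[m' [s' [A [gA le_s KA PA]]]].
exact: (Regular gA le_s KA (IH _ _ _ _ PA)).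
Qed.

Lemma regular_iff d m (s : 'I_m -> nat) K K' :
  (forall v, K v <-> K' v) -> regular d s K -> regular d s K'.
Proof. by move=> KK' [m' s' A gA le_s KA rA]; apply: (Regular gA) => // v; rewrite -KK'. Qed.

Lemma regular_leq d d' m (s : 'I_m -> nat) K : (d <= d')%N -> regular d s K -> regular d' s K.
Proof.
move=> dd' rK; pose P e m (s : 'I_m -> nat) K := exists2 d, (d <= e)%N & regular d s K.
apply: (@regular_coind P); last by exists d.
move=> {dd' rK} {}d' {}m {}s {}K [{}d dd' [m' s' A gA le_s KA rA]].
exists m', s', A; split => // [p|]; first exact: leq_trans (le_s p) dd'.
by exists d.+1.
Qed.

Lemma regular_shift d m (s : 'I_m -> nat) K :
  regular d s K -> regular d.+1 (fun i => (s i).+1) K.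
Proof.
move=> rK; pose P e m (s : 'I_m -> nat) K :=
  exists d s0, [/\ e = d.+1, s = fun i => (s0 i).+1 & regular d s0 K].
apply: (@regular_coind P); last by exists d, s.
move=> {rK} {d m s K} _ m _ K [d [s [-> -> [m' s' A gA le_s KA rA]]]].
exists m', (fun p => (s' p).+1), A; split => //; first exact: graded_addS.
by exists d.+1, s'.
Qed.

Lemma regular_zero d m (s : 'I_m -> nat) : regular d s (fun v => v = 0).
Proof.
pose P (e m : nat) (s : 'I_m -> nat) (K : 'rV[R]_m -> Prop) := K = (fun v => v = 0).
apply: (@regular_coind P); last by [].
move=> {}d {}m {}s _ ->; exists 0, (fun=> 0%N), 0; split=> [|[]//|v|].
- exact: graded_0.
- by split=> [->|[w ->]]; first exists 0; rewrite mulmx0.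
- apply/funext => w; apply/propext; split => _; last exact: mulmx0.
  by apply/rowP => -[].
Qed.

(** The coinduction invariant of the horseshoe lemma: [K] is an extension of its projection to the
    second summand by its intersection with the first. *)
Inductive extension : forall d m : nat, ('I_m -> nat) -> ('rV[R]_m -> Prop) -> Prop :=
  Extension d m1 m2 (s1 : 'I_m1 -> nat) (s2 : 'I_m2 -> nat) K of
    graded_submod (scat s1 s2) K &
    regular d s1 (fun v => K (row_mx v 0)) &
    regular d s2 (fun v => exists u, K (row_mx u v)) :
  @extension d (m1 + m2) (scat s1 s2) K.

(** Horseshoe lemma. Generators of the projection, lifted to [K], join those of the intersection;
    the syzygies of all of them are again an extension of the two syzygy modules. *)
Lemma regular_extension d m1 m2 (s1 : 'I_m1 -> nat) (s2 : 'I_m2 -> nat) K :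
  graded_submod (scat s1 s2) K ->
  regular d s1 (fun v => K (row_mx v 0)) ->
  regular d s2 (fun v => exists u, K (row_mx u v)) ->
  regular d (scat s1 s2) K.
Proof.
move=> gK r1 r2; apply: (@regular_coind extension); last exact: Extension.
move=> _ _ _ _ [] {d m1 m2 s1 s2 K gK r1 r2}.
move=> d m1 m2 s1 s2 K [K0 KD Kh] [n1 t1 A1 gA1 le1 KA1 rA1] [n2 t2 A2 gA2 le2 KA2 rA2].
(* Row p of [X] is the first component of a homogeneous lift to [K] of the generator [row p A2]. *)
have [X gX KX] : exists2 X : 'M[R]_(n2, m1), graded_mx X t2 s1 &
    forall w, K (row_mx (w *m X) (w *m A2)).
  have h p : exists u, graded_mx u (fun _ : 'I_1 => t2 p) s1 /\ K (row_mx u (row p A2)).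
    have /KA2[u Ku] : exists w, row p A2 = w *m A2 by exists (delta_mx 0 p); rewrite rowE.
    exists (hcomp s1 (t2 p) u); split; first exact: graded_hcomp.
    rewrite -(@hcomp_id _ s2 (t2 p) (row p A2)); last exact: graded_row.
    by rewrite -hcomp_row_mx; exact: Kh.
  have [f hf] := choice h; exists (\matrix_p f p).
    by apply: graded_rows => p; rewrite rowK; case: (hf p).
  move=> w; rewrite -mul_mx_row mulmx_sum_row.
  elim/big_ind: _ => [//|u v Ku Kv|p _]; first by rewrite -[u]scale1r; exact: KD.
  rewrite -[_ *: _]addr0; apply: KD => //.
  by rewrite (_ : row p _ = row_mx (f p) (row p A2)); [case: (hf p)|rewrite row_row_mx rowK].
have KB u v u' : K (row_mx u v) -> K (row_mx u' v) -> K (row_mx (u - u') 0).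
  move=> Ku Ku'; rewrite (_ : row_mx _ 0 = (-1) *: row_mx u' v + row_mx u v); first exact: KD.
  by rewrite scaleN1r opp_row_mx add_row_mx addNr addrC.
exists (n1 + n2)%N, (scat t1 t2), (block_mx A1 0 X A2).
have gB : graded_mx (block_mx A1 0 X A2) (scat t1 t2) (scat s1 s2).
  by apply: graded_col_mx; apply: graded_row_mx => //; exact: graded_0.
split=> // [|v|]; first exact: scat_le.
  split=> [|[w ->]].
    rewrite -[v]hsubmxK; set v1 := lsubmx v; set v2 := rsubmx v => Kv.
    have /KA2[w2 v2E] : exists u, K (row_mx u v2) by exists v1.
    have /KA1[w1 w1E] : K (row_mx (v1 - w2 *m X) 0).
      by apply: KB Kv _; rewrite v2E.
    exists (row_mx w1 w2).
    by rewrite mul_row_block mulmx0 add0r -w1E -v2E subrK.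
  rewrite -[w]hsubmxK mul_row_block mulmx0 add0r.
  set w1 := lsubmx w; set w2 := rsubmx w.
  rewrite (_ : row_mx _ _ = 1 *: row_mx (w1 *m A1) 0 + row_mx (w2 *m X) (w2 *m A2)).
    by apply: KD; first by apply/KA1; exists w1.
  by rewrite scale1r add_row_mx add0r.
apply: Extension; first exact: graded_submod_ker gB.
  apply: regular_iff rA1 => w; rewrite mul_row_block !mul0mx mulmx0 !addr0.
  by split=> [->|/eqP]; rewrite ?row_mx0 // row_mx_eq0 => /andP[/eqP].
apply: regular_iff rA2 => w; split=> [wA|[u]]; last first.
  by move/eqP; rewrite mul_row_block mulmx0 add0r row_mx_eq0 => /andP[_ /eqP].
(* A syzygy of [A2] extends to the block matrix: its combination of the lifts lies in the first
   summand, so the rows of [A1] can cancel it. *)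
have /KA1[u uE] : K (row_mx (w *m X) 0) by rewrite -wA.
exists (- u); rewrite mul_row_block mulmx0 add0r wA mulNmx -uE addNr.
exact: row_mx0.
Qed.

End GradedModules.

(** * Regularity of I' + xL *)

Section Ideals.
Variables (k : fieldType) (n : nat).
Local Notation R := {mpoly k[n]}.

Definition regular_ideal d (J : R -> Prop) :=
  regular d (fun _ : 'I_1 => 0%N) (fun v : 'rV[R]_1 => J (v 0 0)).

Lemma mx11_eq0 (M : 'M[R]_1) : (M = 0) = (M 0 0 = 0).
Proof.
apply/propext; split=> [->|h]; first by rewrite mxE.
by apply/rowP => i; rewrite (ord1 i) h mxE.
Qed.

Lemma regular_ideal_gens d (J : R -> Prop) :
  regular_ideal d J ->
  exists m (s : 'I_m -> nat) (A : 'cV[R]_m),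
    [/\ graded_mx A s (fun=> 0%N), (forall p, s p <= d)%N,
        forall f, J f <-> exists w : 'rV_m, f = (w *m A) 0 0 &
        regular d.+1 s (fun w => w *m A = 0)].
Proof.
case=> m s A gA le_s JA rA; exists m, s, A; split=> // f.
have := JA (const_mx f); rewrite mxE => ->; split=> -[w e]; exists w.
  by rewrite -e mxE.
by apply/rowP => i; rewrite (ord1 i) mxE.
Qed.

(** The mapping cone, unrolled into two extensions. Syzygies of I project, with kernel the syzygies
    of I', onto the coefficient vectors over L that evaluate into I'. These are generated by the
    syzygies of L and by lifts of the generators of I'. Multiplication by x raises the shifts on L
    by one. *)
Lemma regular_ideal_add_mul d x (I I' L : R -> Prop) :
  (forall u, u \in msupp x -> mdeg u = 1%N) -> x != 0 ->
  (forall f, I f <-> exists g h, [/\ I' g, L h & f = g + x * h]) ->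
  (forall f, I' (x * f) -> I' f) -> (forall f, I' f -> L f) ->
  regular_ideal d.+1 I' -> regular_ideal d L -> regular_ideal d.+1 I.
Proof.
move=> dx x0 IE colon sub /regular_ideal_gens[m1 [s1 [A1 [gA1 le1 I'A rA1]]]].
move=> /regular_ideal_gens[m2 [s2 [A2 [gA2 le2 LA rA2]]]].
have gxA2 : graded_mx (x *: A2) (fun p => (s2 p).+1) (fun=> 0%N).
  move=> p q u; rewrite mxE => /msuppM_le /allpairsP[[u1 u2] /= [ux uA ->]].
  by rewrite mdegD (dx _ ux) -(gA2 _ _ _ uA) addn0 add1n addn0.
have xI w1 w2 : (w1 *m A1 + w2 *m (x *: A2)) 0 0 = (w1 *m A1) 0 0 + x * (w2 *m A2) 0 0.
  by rewrite -scalemxAr !mxE.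
have gB := graded_col_mx gA1 gxA2.
apply: (Regular gB).
- by apply: scat_le => // i; rewrite ltnS.
- move=> v; rewrite IE; split.
    move=> [g [h [/I'A[w1 ->] /LA[w2 ->]]]]; rewrite -xI => vE.
    by exists (row_mx w1 w2); apply/rowP => i; rewrite (ord1 i) vE mul_row_col.
  move=> [w ->]; exists ((lsubmx w *m A1) 0 0), ((rsubmx w *m A2) 0 0).
  rewrite -xI -mul_row_col hsubmxK; split=> //.
    by apply/I'A; eexists.
  by apply/LA; eexists.
apply: regular_extension; first exact: graded_submod_ker gB.
  by apply: regular_iff rA1 => w; rewrite mul_row_col mul0mx addr0.
(* A relation over [h] puts x times the entry of [h *m A2] in I'; as x is a nonzerodivisor modulo
   I', that entry itself lies in I'. *)
apply: (@regular_iff _ _ _ _ _ (fun h => I' ((h *m A2) 0 0))).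
  move=> h; split.
    move=> /I'A[w hw]; exists (- (x *: w)); rewrite mul_row_col mx11_eq0.
    by rewrite xI hw mulNmx -scalemxAl !mxE addNr.
  move=> [w]; rewrite mul_row_col mx11_eq0 xI => e; apply: colon; apply/I'A.
  by exists (- w); rewrite mulNmx [RHS]mxE; apply/eqP; rewrite -addr_eq0 addrC e.
case: (rA2) => mB sB B gB' leB KB rB.
(* [phi] is the comparison map of the cone, lifting the inclusion of I' in L. *)
have [phi gphi A1E] : exists2 X : 'M[R]_(m1, m2), graded_mx X s1 s2 & A1 = X *m A2.
  apply: (graded_lift gA2 gA1) => p.
  have /sub/LA[w hw] : I' (A1 p 0).
    by apply/I'A; exists (delta_mx 0 p); rewrite -rowE mxE.
  by exists w; apply/rowP => i; rewrite (ord1 i) -hw mxE.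
have gC := graded_col_mx (graded_addS gB') (graded_addS gphi).
apply: (Regular gC).
- by apply: scat_le => i; rewrite ltnS.
- move=> v; rewrite I'A; split=> [[w vw]|[w ->]].
    have /KB[u uE] : (v - w *m phi) *m A2 = 0.
      by rewrite mx11_eq0 mulmxBl -mulmxA -A1E mxE vw [X in _ + X]mxE subrr.
    by exists (row_mx u w); rewrite mul_row_col -uE subrK.
  exists (rsubmx w); rewrite -[w]hsubmxK mul_row_col mulmxDl row_mxKr -(mulmxA (rsubmx w)) -A1E.
  rewrite (_ : _ *m B *m A2 = 0) ?add0r //.
  by apply/KB; eexists.
apply: regular_extension; first exact: graded_submod_ker gC.
  by apply: regular_iff (regular_shift rB) => w; rewrite mul_row_col mul0mx addr0.
(* [w *m phi] is a combination of the syzygies [B] of L exactly when [w *m A1 = 0]. *)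
apply: regular_iff (regular_shift rA1) => w; rewrite A1E mulmxA; split.
  by move=> /KB[u uE]; exists (- u); rewrite mul_row_col mulNmx -uE addNr.
move=> [u]; rewrite mul_row_col => /eqP; rewrite addrC addr_eq0 => /eqP ->.
apply/KB; exists (- u); exact/esym/mulNmx.
Qed.

End Ideals.

(** * Minimal resolutions *)

Section MinimalResolutions.
Variables (k : fieldType) (n : nat).
Local Notation R := {mpoly k[n]}.

Lemma mul_col'_row' m m' (q : 'I_m.+1) (v : 'rV[R]_m.+1) (A : 'M[R]_(m.+1, m')) :
  v 0 q = 0 -> (col' q v : 'rV_m) *m (row' q A : 'M_(m, m')) = v *m A.
Proof.
move=> vq; apply/rowP => j; rewrite !mxE (bigD1_ord q) //= vq mul0r add0r.
by apply: eq_bigr => i _; rewrite !mxE.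
Qed.

(* A syzygy [w] with [w_q = 1] makes the generator [q] redundant.  The syzygies
   of the remaining generators form [ker A / R w]. *)
Lemma regular_drop d m m' (A : 'M[R]_(m.+1, m')) s s' (w : 'rV[R]_m.+1) q :
  graded_mx A s s' -> (forall p, s p <= d)%N ->
  regular d.+1 s (fun v : 'rV[R]_m.+1 => v *m A = 0) ->
  graded_mx w (fun=> s q) s -> w 0 q = 1 -> w *m A = 0 ->
  [/\ graded_mx (row' q A : 'M_(m, m')) (fun p => s (lift q p)) s',
     (forall v : 'rV[R]_m', (exists u, v = u *m A) <-> exists u, v = u *m (row' q A : 'M_(m, m'))) &
     regular d.+1 (fun p => s (lift q p)) (fun v : 'rV[R]_m => v *m (row' q A : 'M_(m, m')) = 0)].
Proof.
move=> gA le_s [mB sB B gB leB KB rB] gw wq wA.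
have red (v : 'rV[R]_m.+1) : (v - v 0 q *: w) 0 q = 0 by rewrite !mxE wq mulr1 subrr.
have redA (v : 'rV[R]_m.+1) : (v - v 0 q *: w) *m A = v *m A.
  by rewrite mulmxBl -scalemxAl wA scaler0 subr0.
pose ins (u : 'rV[R]_m) : 'rV[R]_m.+1 := \row_i oapp (u 0) 0 (unlift q i).
have insq u : ins u 0 q = 0 by rewrite mxE unlift_none.
have insK u : col' q (ins u) = u by apply/rowP => i; rewrite !mxE liftK.
have insA u : u *m (row' q A : 'M_(m, m')) = ins u *m A.
  by rewrite -[in LHS](insK u) mul_col'_row'.
have imA (v : 'rV_m') : (exists u, v = u *m A) <-> exists u, v = u *m (row' q A : 'M_(m, m')).
  split=> -[u ->]; last by exists (ins u).
  by exists (col' q (u - u 0 q *: w)); rewrite mul_col'_row'.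
split=> //; first by move=> i j u; rewrite mxE; exact: gA.
(* The rows of [B], reduced modulo [w] so that coordinate q vanishes, with that coordinate
   removed. *)
pose D : 'M[R]_(mB, m) := col' q (B - col q B *m w).
have DE z : z *m D = col' q (z *m B - (z *m B) 0 q *: w).
  have -> : z *m D = col' q (z *m (B - col q B *m w)).
    by apply/rowP => i; rewrite !mxE; apply: eq_bigr => j _; rewrite !mxE.
  congr (col' q _); rewrite mulmxBr mulmxA; congr (_ - _).
  rewrite [z *m col q B]mx11_scalar mul_scalar_mx !mxE; congr (_ *: _).
  by apply: eq_bigr => j _; rewrite mxE.
have gD : graded_mx D sB (fun p => s (lift q p)).
  move=> i j u; rewrite !mxE => /msuppB_le; rewrite mem_cat => /orP[/gB //|].
  rewrite big_ord1 !mxE => /msuppM_le /allpairsP[[u1 u2] /= [u1B u2w ->]].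
  by rewrite mdegD -addnA (gw _ _ _ u2w) (gB _ _ _ u1B).
(* [w] is the combination [t] of the rows of [B], so the relations among the rows of [D] are those
   of [B] together with [t]. *)
have [t gt tB] : exists2 t : 'rV[R]_mB, graded_mx t (fun=> s q) sB & w = t *m B.
  by apply: (graded_lift gB gw) => p; apply/KB; rewrite (ord1 p) row_id.
apply: (Regular gD leB) => [u|].
  split=> [uA|[z ->]].
    have /KB[z zE] : ins u *m A = 0 by rewrite -insA.
    by exists z; rewrite DE -zE insq scale0r subr0 insK.
  rewrite DE mul_col'_row' // redA.
  by apply/KB; exists z.
case: rB => mC sC C gC leC KC rC.
have gCt := graded_col_mx gC gt.
apply: (Regular gCt).
- by apply: scat_le => // _; apply: leq_trans (le_s q) _; lia.
- move=> z; split=> [|[y ->]].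
    rewrite DE => zD.
    have zB : z *m B = (z *m B) 0 q *: w.
      apply/eqP; rewrite -subr_eq0; apply/eqP/rowP => j.
      case: (unliftP q j) => [i ->|->]; last by rewrite red mxE.
      by have /rowP/(_ i) := zD; rewrite !mxE.
    have /KC[y yE] : (z - (z *m B) 0 q *: t) *m B = 0.
      by rewrite mulmxBl -scalemxAl -tB -zB subrr.
    exists (row_mx y ((z *m B) 0 q)%:M).
    by rewrite mul_row_col mul_scalar_mx -yE subrK.
  rewrite -[y]hsubmxK mul_row_col; move: (lsubmx y) (rsubmx y) => {}y a.
  rewrite [a]mx11_scalar mul_scalar_mx; move: (a 0 0) => {}a.
  have yCB : y *m C *m B = 0 by apply/KC; exists y.
  rewrite DE mulmxDl yCB add0r -scalemxAl -tB; apply/rowP => j.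
  by rewrite !mxE wq mulr1 subrr.
apply: regular_extension; first exact: graded_submod_ker gCt.
  by apply: regular_iff rC => y; rewrite mul_row_col mul0mx addr0.
(* [t] is free modulo the relations of [B]: if [a *: t] is one of them then [a *: w = 0], and
   coordinate q gives a = 0. *)
apply: regular_iff (regular_zero _ _ _ _) => a; split=> [->|[y]].
  by exists 0; rewrite mul_row_col !mul0mx addr0.
rewrite mul_row_col => /(congr1 (mulmx^~ B)); rewrite mulmxDl mul0mx.
have -> : y *m C *m B = 0 by apply/KC; exists y.
rewrite add0r -mulmxA -tB [a]mx11_scalar mul_scalar_mx => /rowP/(_ q).
by rewrite !mxE wq mulr1 => ->; rewrite raddf0.
Qed.

(** While some syzygy has an entry with nonzero constant term, a generator is dropped; the rank
    decreases, so this stops. The last clause makes the next differential minimal. *)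
Lemma regular_minimal_gens d m (s : 'I_m -> nat) (K : 'rV[R]_m -> Prop) :
  regular d s K ->
  exists m' (s' : 'I_m' -> nat) (A : 'M[R]_(m', m)),
    [/\ graded_mx A s' s, (forall p, s' p <= d)%N,
        (forall v, K v <-> exists w, v = w *m A),
        regular d.+1 s' (fun w => w *m A = 0) &
        forall w : 'rV_m', w *m A = 0 -> forall q, (w 0 q)@_0%MM = 0].
Proof.
case=> m' s' A; elim: m' s' A => [|m' IH] s' A gA le_s KA rA.
  by exists 0%N, s', A; split=> // w _ [].
have [min|] := pselect (forall w : 'rV_m'.+1, w *m A = 0 -> forall q, (w 0 q)@_0%MM = 0).
  by exists m'.+1, s', A.
move=> /existsNP[w /not_implyP[wA /existsNP[q wq]]].
(* In the component of degree [s' q], entry q has degree 0, so it is the constant [c]; dividing by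
   it gives the entry 1. *)
pose w1 := hcomp s' (s' q) w; set c := (w 0 q)@_0%MM in wq.
have w1q : w1 0 q = c%:MP.
  rewrite mxE; apply/mpolyP => u; rewrite mcoeff_msel mcoeffC.
  rewrite -{2}[s' q]add0n eqn_add2r mdeg_eq0.
  by case: eqP => [->|_]; rewrite ?mulr1 ?mulr0.
have gw1 : graded_mx (c^-1%:MP *: w1) (fun=> s' q) s'.
  move=> i j u; rewrite mxE mul_mpolyC => /msuppZ_le; exact: graded_hcomp.
have w11 : (c^-1%:MP *: w1) 0 q = 1.
  by rewrite mxE w1q -mpolyCM mulVf //; apply/eqP.
have w1A : (c^-1%:MP *: w1) *m A = 0.
  by rewrite -scalemxAl -(hcomp_mul _ _ gA) wA hcomp0 scaler0.
have [gA' imA rA'] := regular_drop gA le_s rA gw1 w11 w1A.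
by apply: (IH _ _ gA') => // v; rewrite KA imA.
Qed.

(** [regular] is a proposition and carries no data. Packaging it, with a cover picked by choice,
    turns passing to syzygies into a function, whose iterates form the resolution. *)
Record regular_module := RegularModule {
  rm_deg : nat;
  rm_rank : nat;
  rm_shift : 'I_rm_rank -> nat;
  rm_mem : 'rV[R]_rm_rank -> Prop;
  rm_regular : regular rm_deg rm_shift rm_mem
}.

Record minimal_cover (M : regular_module) := MinimalCover {
  mc_rank : nat;
  mc_shift : 'I_mc_rank -> nat;
  mc_map : 'M[R]_(mc_rank, rm_rank M);
  mc_graded : graded_mx mc_map mc_shift (@rm_shift M);
  mc_shift_le : forall p, (mc_shift p <= rm_deg M)%N;
  mc_im : forall v, rm_mem v <-> exists w, v = w *m mc_map;
  mc_regular : regular (rm_deg M).+1 mc_shift (fun w => w *m mc_map = 0);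
  mc_minimal : forall w : 'rV_mc_rank, w *m mc_map = 0 -> forall q, (w 0 q)@_0%MM = 0
}.

Lemma minimal_cover_inhabited M : inhabited (minimal_cover M).
Proof.
have [m [s [A [h1 h2 h3 h4 h5]]]] := regular_minimal_gens (rm_regular M).
exact: (inhabits (MinimalCover h1 h2 h3 h4 h5)).
Qed.

Definition cover M := inhabited_witness (minimal_cover_inhabited M).

Definition syzygy M := RegularModule (mc_regular (cover M)).

Lemma regular_minimal_resolution d (J : set R) :
  regular_ideal d J ->
  exists2 F : free_seq k n, minimal_graded_free_resolution F J &
    forall i (p : 'I_(rk F i)), (shift p <= d + i)%N.
Proof.
move=> rJ; pose M i := iter i syzygy (RegularModule rJ).
have Mdeg i : rm_deg (M i) = (d + i)%N.
  by elim: i => [|i IH]; rewrite ?addn0 //= IH addnS.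
pose F := FreeSeq (fun i p => @mc_shift _ (cover (M i)) p)
  (fun i => mc_map (cover (M i.+1))) (mc_map (cover (M 0%N))).
exists F; last by move=> i p; rewrite -Mdeg; exact: mc_shift_le.
split; first split.
- move=> p; apply/dhomogP => u /(@mc_graded _ (cover (M 0%N))) /=.
  by rewrite addn0.
- by move=> i p q u; exact: (@mc_graded _ (cover (M i.+1))).
- split.
  + move=> f; have /= := @mc_im _ (cover (M 0%N)) (const_mx f); rewrite mxE => ->.
    split=> -[w e]; exists w; first by rewrite -e mxE.
    by apply/rowP => i; rewrite (ord1 i) mxE.
  + exact: (@mc_im _ (cover (M 1%N))).
  + by move=> i; exact: (@mc_im _ (cover (M i.+2))).
(* The rows of differential [i] are syzygies of the cover of [M i], whose entries have no constant
   term. *)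
- move=> i p q; have /= := @mc_minimal _ (cover (M i)) (row p (mc_map (cover (M i.+1)))).
  move=> /(_ _ q); rewrite mxE; apply.
  have [_] := @mc_im _ (cover (M i.+1)) (row p (mc_map (cover (M i.+1)))); apply.
  by exists (delta_mx 0 p); rewrite rowE.
Qed.

Lemma regular_has_reg d (J : set R) :
  regular_ideal d J -> nonzero_ideal J ->
  exists2 e : int, has_reg J e & e <= d%:Z.
Proof.
move=> /regular_minimal_resolution[F minF le_s] [f Jf f0].
have [p0] : exists p0 : 'I_(rk F 0), True.
  have [_ [/(_ f)[/(_ Jf)[v fE] _] _ _] _] := minF.
  case: (rk F 0) v (aug F) fE => [|m] v A fE; last by exists ord0.
  by move: f0; rewrite fE mxE big_ord0 eqxx.
(* [P c] says that the slack [d + i - shift p] takes the value c; the least slack gives the largest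
   [shift p - i]. *)
pose P c := `[< exists i (p : 'I_(rk F i)), (shift p + c = d + i)%N >].
have exP : exists c, P c.
  by exists (d - shift p0)%N; apply/asboolP; exists 0%N, p0; have := le_s _ p0; lia.
case: (ex_minnP exP) => c /asboolP[i [p e]] minc.
exists (d%:Z - c%:Z); last lia.
exists F; split=> //; last by exists i, p; lia.
move=> j q; have /minc : P (d + j - shift q)%N.
  by apply/asboolP; exists j, q; have := le_s _ q; lia.
have := le_s _ q; lia.
Qed.

End MinimalResolutions.

(** * Edge ideals *)

Section MonomialIdeals.
Variables (k : fieldType) (n : nat).
Local Notation R := {mpoly k[n]}.
Implicit Types (M : 'X_{1..n} -> Prop) (x : 'I_n) (V Y : {set 'I_n}).

(** Membership is read off the support, with no choice of generators; this is an ideal once [M] is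
    closed under adding exponents. *)
Definition monomial_ideal M : R -> Prop := fun f => forall u, u \in msupp f -> M u.

Definition regular_monomial d M := regular_ideal d (monomial_ideal M).

Lemma regular_monomial_iff d M M' :
  (forall u, M u <-> M' u) -> regular_monomial d M -> regular_monomial d M'.
Proof. by move=> h; rewrite (_ : M = M') //; apply/funext => u; apply/propext. Qed.

Lemma regular_monomial_leq d d' M : (d <= d')%N -> regular_monomial d M -> regular_monomial d' M.
Proof. exact: regular_leq. Qed.

Lemma regular_monomial_False d M : (forall u, ~ M u) -> regular_monomial d M.
Proof.
move=> M0; apply: regular_iff (regular_zero _ _ _ _) => v; split=> [-> u|h].
  by rewrite mxE msupp0.
apply/rowP => i; rewrite (ord1 i) mxE; apply/msuppnil0.
by case vE: (msupp _) => [//|u s]; have := h u; rewrite vE mem_head => /(_ isT)/M0.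
Qed.

Lemma regular_monomial_True d M : (forall u, M u) -> regular_monomial d M.
Proof.
move=> M1; apply: (@Regular _ _ _ _ _ _ _ (fun _ : 'I_1 => 0%N) 1%:M) => //.
- move=> p q u; rewrite (ord1 p) (ord1 q) mxE eqxx mcoeff_msupp mcoeff1.
  by case: (u =P 0%MM) => [->|_]; rewrite ?mdeg0 ?eqxx.
- by move=> v; split=> [_|_ u _]; [exists v; rewrite mulmx1|exact: M1].
- by apply: regular_iff (regular_zero _ _ _ _) => v; rewrite mulmx1.
Qed.

Lemma mnm_split x (u : 'X_{1..n}) : (0 < u x)%N -> u = ((u - U_(x)) + U_(x))%MM.
Proof.
move=> ux; rewrite submK //; apply/mnm_lepP => i; rewrite mnm1E.
by case: eqP => // <-.
Qed.

(** Here I' is spanned by [M'], which ignores the exponent of x and agrees with [M] where that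
    exponent is 0; L = I : x is spanned by the monomials that x carries into I. *)
Lemma regular_monomial_step d x M M' :
  (forall u v, M u -> M (u + v)%MM) ->
  (forall u : 'X_{1..n}, u x = 0%N -> (M' u <-> M u)) -> (forall u, M' (u + U_(x))%MM <-> M' u) ->
  regular_monomial d.+1 M' -> regular_monomial d (fun u => M (u + U_(x))%MM) ->
  regular_monomial d.+1 M.
Proof.
move=> Mup M'M M'x.
(* Induction on the exponent of x: [M'] permits removing a factor x, and [M] absorbs it again. *)
have M'subM u : M' u -> M u.
  move: {2}(u x) (erefl (u x)) => i; elim: i u => [|i IH] u ux; first by move/M'M; apply.
  have u0 : (0 < u x)%N by rewrite ux.
  rewrite (mnm_split u0) M'x => /IH h; apply: Mup; apply: h.
  by rewrite mnmBE mnm1E eqxx ux subn1.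
apply: (@regular_ideal_add_mul _ _ _ 'X_x).
- by move=> u; rewrite msuppX inE => /eqP ->; rewrite mdeg1.
- by rewrite -msupp_eq0 msuppX.
- move=> f; split=> [If|[g [h [I'g Lh ->]]]]; last first.
    move=> u /msuppD_le; rewrite mem_cat => /orP[/I'g/M'subM //|].
    move/msuppM_le/allpairsP => [[u1 u2] /= [+ u2h ->]].
    by rewrite msuppX inE => /eqP ->; rewrite addmC; exact: Lh.
  exists (msel (fun u => u x == 0%N) f).
  exists (\sum_(u <- msupp f | u x != 0%N) f@_u *: 'X_[u - U_(x)]); split.
  + by move=> u /msel_supp[/eqP ux /If]; exact: (M'M u ux).2.
  + move=> v /msupp_sum_le /flattenP[s /mapP[u]].
    rewrite mem_filter => /andP[ux uf ->] /msuppZ_le; rewrite msuppX inE => /eqP ->.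
    by rewrite -mnm_split ?lt0n //; exact: If.
  + rewrite mulr_sumr {1}(mpolyE f) (bigID (fun u : 'X_{1..n} => u x == 0%N)) /=; congr (_ + _).
    apply: eq_bigr => u ux; rewrite -scalerAr -mpolyXD addmC -mnm_split //.
    by rewrite lt0n.
- move=> f h u uf; rewrite -M'x; apply: h.
  by rewrite mulrC addmC mcoeff_msupp mcoeffMX -mcoeff_msupp.
- by move=> f h u /h /M'subM /Mup.
Qed.

Variable e : rel 'I_n.

(** For irreflexive [e], the monomials of the edge ideal of the graph induced on [V]. The relation
    may be oriented, which is why [nbr] looks in both directions. *)
Definition edge_monomial V (u : 'X_{1..n}) :=
  exists a b, [/\ a \in V, b \in V, e a b, (0 < u a)%N & (0 < u b)%N].

Definition nbr x V := [set y in V | e x y || e y x].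

Lemma edge_monomialD V u v : edge_monomial V u -> edge_monomial V (u + v)%MM.
Proof. by case=> a [b [aV bV eab ua ub]]; exists a, b; rewrite !mnmDE !addn_gt0 ua ub. Qed.

(** The variables are adjoined one at a time. This does not raise the regularity, because the colon
    ideal by the new variable is the unit ideal, of regularity 0. *)
Lemma regular_add_vars d V (Y : {set 'I_n}) :
  [disjoint V & Y] -> regular_monomial d.+1 (edge_monomial V) ->
  regular_monomial d.+1 (fun u => (exists2 y, y \in Y & (0 < u y)%N) \/ edge_monomial V u).
Proof.
move: {2}#|Y| (erefl #|Y|) => c; elim: c Y => [|c IH] Y cY dis rV.
  apply: regular_monomial_iff rV => u; split=> [|[[y]|//]]; first by right.
  by move/cards0_eq: cY => ->; rewrite inE.
have /card_gt0P[x xY] : (0 < #|Y|)%N by rewrite cY.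
have xV : x \notin V by apply: contraL xY => xV; rewrite (disjointFr dis xV).
apply: (@regular_monomial_step _ x _ (fun u => (exists2 y, y \in Y :\ x & (0 < u y)%N) \/ edge_monomial V u)).
- move=> u v [[y yY uy]|/edge_monomialD]; [left|by right].
  by exists y => //; rewrite mnmDE addn_gt0 uy.
- move=> u ux; split=> -[[y yY uy]|]; try by right.
    by left; exists y => //; case/setD1P: yY.
  by left; exists y => //; rewrite !inE yY andbT; apply: contraTneq uy => ->; rewrite ux.
- have Ux y (u : 'X_{1..n}) : y != x -> (u + U_(x))%MM y = u y.
    by move=> yx; rewrite mnmDE mnm1E eq_sym (negPf yx) addn0.
  have nx y : y \in V -> y != x by move=> yV; apply: contraNneq xV => <-.
  move=> u; split=> -[[y yY uy]|[a [b [aV bV eab ua ub]]]].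
  + by left; exists y => //; move: uy; rewrite Ux //; case/setD1P: yY.
  + by right; exists a, b; split=> //; [rewrite -(Ux a u)|rewrite -(Ux b u)]; rewrite // nx.
  + by left; exists y => //; rewrite Ux //; case/setD1P: yY.
  + by right; exists a, b; split=> //; rewrite Ux // nx.
- apply: IH => //; first by move: cY; rewrite (cardsD1 x) xY => -[].
  by apply: disjointWr dis; exact: subD1set.
- by apply: regular_monomial_True => u; left; exists x => //; rewrite mnmDE mnm1E eqxx addn1.
Qed.

Hypothesis irr : irreflexive e.

(** The colon ideal by x is generated by the neighbours of x, as variables, and by the edges that
    avoid them and x; [regular_add_vars] disposes of these variables. *)
Lemma regular_vertex d V x : x \in V ->
  regular_monomial d.+2 (edge_monomial (V :\ x)) ->
  regular_monomial d.+1 (edge_monomial (V :\ x :\: nbr x V)) ->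
  regular_monomial d.+2 (edge_monomial V).
Proof.
move=> xV r1 r2.
have Ux y (u : 'X_{1..n}) : y != x -> (u + U_(x))%MM y = u y.
  by move=> yx; rewrite mnmDE mnm1E eq_sym (negPf yx) addn0.
apply: (@regular_monomial_step _ x _ (edge_monomial (V :\ x))) => //.
- exact: edge_monomialD.
- move=> u ux; split=> -[a [b [aV bV eab ua ub]]]; exists a, b; split=> //.
  + by case/setD1P: aV.
  + by case/setD1P: bV.
  + by rewrite !inE aV andbT; apply: contraTneq ua => ->; rewrite ux.
  + by rewrite !inE bV andbT; apply: contraTneq ub => ->; rewrite ux.
- move=> u; split=> -[a [b [aV bV eab ua ub]]]; exists a, b; split=> //;
    move: ua ub; rewrite !Ux //; by [case/setD1P: aV|case/setD1P: bV].
apply: regular_monomial_iff (@regular_add_vars _ _ (nbr x V) _ r2); last first.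
  by rewrite -setI_eq0; apply/eqP/setP => y; rewrite !inE; case: (y \in V); case: (_ || _); rewrite ?andbF.
have xx : x \notin nbr x V by rewrite inE irr andbF.
move=> u; split=> [[[y yN uy]|[a [b [aV bV eab ua ub]]]]|[a [b [aV bV eab ua ub]]]].
- have yx : y != x by apply: contraTneq yN => ->.
  move: yN; rewrite inE => /andP[yV /orP[]] exy; [exists x, y|exists y, x];
    by split=> //; first [by rewrite Ux | by rewrite mnmDE mnm1E eqxx addn1].
- exists a, b; move: aV bV; rewrite !inE => /and3P[_ ax aV] /and3P[_ bx bV].
  by rewrite !Ux.
- have [ax|ax] := eqVneq a x.
    left; exists b; first by rewrite inE bV -ax eab.
    by rewrite -(Ux b u) // -ax; apply: contraTneq eab => ->; rewrite irr.
  have [bx|bx] := eqVneq b x.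
    by left; exists a; [rewrite inE aV -bx eab orbT|rewrite -(Ux a u)].
  rewrite !Ux // in ua ub.
  have [aN|aN] := boolP (a \in nbr x V); first by left; exists a.
  have [bN|bN] := boolP (b \in nbr x V); first by left; exists b.
  by right; exists a, b; split=> //; rewrite finset.in_setD ?aN ?bN finset.in_setD1 ?ax ?bx.
Qed.

Lemma edge_monomial_sub V V' : V \subset V' ->
  (forall a b, a \in V' -> b \in V' -> e a b -> (a \in V) && (b \in V)) ->
  forall u, edge_monomial V u <-> edge_monomial V' u.
Proof.
move=> /fintype.subsetP sub h u; split=> -[a [b [aV bV eab ua ub]]]; exists a, b; split=> //;
  by [exact: sub| case/andP: (h a b aV bV eab)].
Qed.

End MonomialIdeals.

(** * Regularity of the graph of shifted edges *)

Section ShiftedGraph.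
Variables (k : fieldType) (r n : nat) (E : 'I_r -> 'I_r -> bool).
Hypothesis E_lt : forall i j, E i j -> (i < j)%N.

(* [(a, b)] is the image of an edge [(i, j)] under some element of Inc_{r,n}. *)
Definition shifted_edge (a b : 'I_n) : bool :=
  [exists i : 'I_r, exists j : 'I_r,
    [&& E i j, (i <= a)%N, (j + a <= i + b)%N & (b + r <= n + j)%N]].

Lemma shifted_edgeP (a b : 'I_n) :
  reflect (exists i j : 'I_r, [/\ E i j, (i <= a)%N, (j + a <= i + b)%N & (b + r <= n + j)%N])
          (shifted_edge a b).
Proof.
apply: (iffP existsP) => [[i /existsP[j /and4P[]]]|[i [j []]]]; first by exists i, j.
by move=> *; exists i; apply/existsP; exists j; apply/and4P.
Qed.

Lemma shifted_edge_lt a b : shifted_edge a b -> (a < b)%N.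
Proof. by move/shifted_edgeP => [i [j [/E_lt]]]; lia. Qed.

Lemma shifted_edge_irr : irreflexive shifted_edge.
Proof. by move=> a; apply: contraFF (ltnn a); exact: shifted_edge_lt. Qed.

Hypotheses (r_gt0 : (0 < r)%N) (le_4r_n : (4 * r <= n)%N).

Local Notation reg d V := (regular_monomial k d (edge_monomial shifted_edge V)).

(* On vertices [a >= r - 1] the complement is an interval graph: the smallest
   vertex is adjacent to the larger end of every edge. *)
Lemma regular_right (V : {set 'I_n}) :
  (forall a, a \in V -> (r.-1 <= a)%N) -> reg 2 V.
Proof.
move: {2}#|V| (erefl #|V|) => c; elim: c V => [|c IH] V cV Vr.
  apply: regular_monomial_False => u [a [b []]].
  by rewrite (cards0_eq cV) inE.
have /card_gt0P[x0 x0V] : (0 < #|V|)%N by rewrite cV.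
case: (arg_minnP (fun a : 'I_n => val a) x0V) => x; rewrite -/(x \in V) => xV xmin.
apply: (regular_vertex shifted_edge_irr xV).
  apply: IH; first by move: cV; rewrite (cardsD1 x) xV => -[].
  by move=> a /setD1P[_]; exact: Vr.
apply: regular_monomial_False => u [a [b [aV bV /shifted_edgeP[i [j [Eij ia jb bn]]] _ _]]].
move: aV bV; rewrite !inE => /and3P[_ _ aV] /and3P[/negP xb _ bV].
(* The pair (i, j) that makes ab an edge also makes xb one: i <= r - 1 <= x, and x <= a only widens
   the gap to b. *)
apply: xb; rewrite bV; apply/orP; left; apply/shifted_edgeP; exists i, j.
have xa : (x <= a)%N := xmin a aV.
by have := Vr x xV; have := ltn_ord i; split=> //; lia.
Qed.

(* Delete [v = n - r, .., 0] in turn, always keeping the vertices above [n - r];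
   among the non-neighbours of [v] all edges lie on vertices [>= r - 1]. *)
Lemma regular_shifted : reg 3 [set: 'I_n].
Proof.
pose V v := [set a : 'I_n | (a < v)%N || (n < a + r)%N].
have -> : [set: 'I_n] = V (n - r).+1.
  by apply/setP => a; rewrite !inE; apply/esym; lia.
suff h v : (v <= (n - r).+1)%N -> reg 3 (V v) by exact: h.
elim: v => [_|v IH lev].
  (* Only the vertices above n - r remain, all of them at least r - 1. *)
  apply: (@regular_monomial_leq _ _ 2) => //; apply: regular_right => a.
  by rewrite inE; lia.
have ltv : (v < n)%N by lia.
pose x := Ordinal ltv.
have xV : x \in V v.+1 by rewrite inE /= ltnSn.
have Vx : V v.+1 :\ x = V v.
  by apply/setP => a; rewrite !inE -val_eqE /=; lia.
apply: (regular_vertex shifted_edge_irr xV); rewrite Vx; first by apply: IH; lia.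
set S := V v :\: _.
have Sin a : a \in S -> [/\ (a < v)%N || (n < a + r)%N, ~ shifted_edge x a & ~ shifted_edge a x].
  rewrite !inE => /andP[h1 h2]; split=> // h; move/negP: h1; apply; rewrite h ?orbT andbT ltnS;
    move: h2; lia.
apply: (@regular_monomial_iff _ _ _ (edge_monomial shifted_edge [set a in S | (r.-1 <= a)%N])); last first.
  by apply: regular_right => a; rewrite inE => /andP[].
apply: edge_monomial_sub => [|a b aS bS].
  by apply/fintype.subsetP => a; rewrite inE => /andP[].
rewrite finset.in_set aS finset.in_set bS /=; move=> eab; have ltab := shifted_edge_lt eab.
have {aS}[aV nxa nax] := Sin a aS; have {bS}[bV nxb nbx] := Sin b bS.
have [i [j [Eij ia jb bn]]] := shifted_edgeP _ _ eab.
have ltij := E_lt Eij; have ltj := ltn_ord j.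
have ax : ~~ [&& i <= a, j + a <= i + v & v + r <= n + j]%N.
  by apply/negP => /and3P[h1 h2 h3]; apply: nax; apply/shifted_edgeP; exists i, j.
have xb : ~~ [&& i <= v, j + v <= i + b & b + r <= n + j]%N.
  by apply/negP => /and3P[h1 h2 h3]; apply: nxb; apply/shifted_edgeP; exists i, j.
(* Suppose a < r - 1; then a < v. As av is no edge, v - a < j - i <= b - a, so b > v. As vb is no
   edge, b - v < j - i, so b < a + 2 (j - i) < 3r. But b > v is kept only if b > n - r >= 3r. *)
lia.
Qed.

End ShiftedGraph.

(** * Stable chains *)

Lemma Inc_gap pi i j : Inc pi -> (i <= j)%N -> (pi i + j <= pi j + i)%N.
Proof.
move=> hpi /subnK <-; elim: (j - i)%N => [|d IH]; first by rewrite add0n addnC.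
have := hpi (d + i)%N (d + i).+1 (ltnSn _); rewrite addSn; lia.
Qed.

Lemma Inc_ge pi i : Inc pi -> (i <= pi i)%N.
Proof. by move=> hpi; have := Inc_gap hpi (leq0n i); lia. Qed.

Lemma sqfree_quadraticP n (u : 'X_{1..n}) :
  sqfree_quadratic u -> exists i j : 'I_n, (i < j)%N /\ u = (U_(i) + U_(j))%MM.
Proof.
move=> [du u1].
have /existsP[i ui] : [exists i, (0 < u i)%N].
  apply: contra_eqT du => /existsPn u0; rewrite (_ : u = 0%MM) ?mdeg0 //.
  by apply/mnmP => i; rewrite mnm0E; have := u0 i; lia.
have uE := mnm_split ui.
have /mdeg1P[j /eqP uj] : mdeg (u - U_(i)) == 1%N.
  by move: du; rewrite {1}uE mdegD mdeg1 addn1 => -[->].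
rewrite uj in uE.
have := u1 i; rewrite uE mnmDE !mnm1E eqxx.
case: (ltngtP i j) => [lt_ij _|lt_ji _|/val_inj <-]; last by rewrite eqxx.
  by exists i, j; rewrite addmC.
by exists j, i.
Qed.

Section IdealGen.
Variables (A : comNzRingType) (S : set A).

Lemma ideal_gen_min (J : A -> Prop) :
  J 0 -> (forall f g, J f -> J g -> J (f + g)) -> (forall a f, S f -> J (a * f)) ->
  forall f, ideal_gen S f -> J f.
Proof.
move=> J0 JD JM f [s [sS ->]]; rewrite big_seq.
by elim/big_ind: _ => // c /sS; exact: JM.
Qed.

Lemma ideal_gen_mul a f : S f -> ideal_gen S (a * f).
Proof.
by move=> Sf; exists [:: (a, f)]; split=> [c|]; rewrite ?big_seq1 // inE => /eqP ->.
Qed.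

Lemma ideal_gen_sum (T : eqType) (s : seq T) (F : T -> A) :
  (forall t, t \in s -> ideal_gen S (F t)) -> ideal_gen S (\sum_(t <- s) F t).
Proof.
elim: s => [|t s IH] h; first by exists [::]; rewrite !big_nil.
have [s1 [S1 e1]] := h t (mem_head _ _).
have [s2 [S2 e2]] : ideal_gen S (\sum_(t <- s) F t).
  by apply: IH => t' t's; apply: h; rewrite inE t's orbT.
exists (s1 ++ s2); split=> [c|]; first by rewrite mem_cat => /orP[/S1|/S2].
by rewrite big_cons big_cat /= -e1 -e2.
Qed.

End IdealGen.

Section StableEdgeIdeals.
Variables (k : fieldType) (r : nat).

Lemma monomial_ideal0 m (M : 'X_{1..m} -> Prop) : @monomial_ideal k m M 0.
Proof. by move=> u; rewrite msupp0. Qed.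

Lemma monomial_idealD m (M : 'X_{1..m} -> Prop) f g :
  @monomial_ideal k m M f -> monomial_ideal M g -> monomial_ideal M (f + g).
Proof. by move=> hf hg u /msuppD_le; rewrite mem_cat => /orP[/hf|/hg]. Qed.

Lemma monomial_idealM m (M : 'X_{1..m} -> Prop) a f :
  (forall u v, M u -> M (u + v)%MM) ->
  @monomial_ideal k m M f -> monomial_ideal M (a * f).
Proof.
move=> Mup hf u /msuppM_le/allpairsP[[u1 u2] /= [_ /hf Mu ->]].
by rewrite addmC; exact: Mup.
Qed.

(** Edges are oriented upwards so that j - i is the gap of an edge. The two properties serve the two
    inclusions in the description of I_n by shifted edges. *)
Lemma edge_ideal_monomial (J : set {mpoly k[r]}) :
  is_edge_ideal J ->
  exists2 E : rel 'I_r, (forall i j, E i j -> (i < j)%N) &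
    (forall f, J f -> monomial_ideal (edge_monomial E [set: 'I_r]) f) /\
    (forall i j, E i j -> J ('X_i * 'X_j)).
Proof.
move=> [S [sqS ->]].
exists (fun i j : 'I_r => (i < j)%N && `[< S (U_(i) + U_(j))%MM >]) => [i j /andP[]//|].
split=> [f|i j /andP[_ /asboolP SX]]; last first.
  by rewrite -[_ * _]mul1r; apply: ideal_gen_mul; exists (U_(i) + U_(j))%MM; rewrite ?mpolyXD.
apply: ideal_gen_min; [exact: monomial_ideal0|exact: monomial_idealD|].
move=> a _ [u Su ->]; apply: monomial_idealM; first exact: edge_monomialD.
move=> v; rewrite msuppX inE => /eqP ->.
have [i [j [lt_ij uE]]] := sqfree_quadraticP (sqS u Su).
exists i, j; rewrite !inE lt_ij /= -uE; split=> //; first exact/asboolP.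
  by rewrite uE mnmDE mnm1E eqxx.
by rewrite uE mnmDE !mnm1E eqxx addn1.
Qed.

Hypothesis r_gt0 : (0 < r)%N.

Lemma inc_act_monomial n (E : rel 'I_r) pi (f : {mpoly k[r]}) :
  (forall i j, E i j -> (i < j)%N) -> Inc_mn r n pi ->
  monomial_ideal (edge_monomial E [set: 'I_r]) f ->
  monomial_ideal (edge_monomial (@shifted_edge r n E) [set: 'I_n]) (inc_act n pi f).
Proof.
move=> E_lt [Ipi pi_n] hf; rewrite /inc_act /mmap big_seq.
elim/big_ind: _ => [||u uf]; [exact: monomial_ideal0|exact: monomial_idealD|].
have [i [j [_ _ Eij ui uj]]] := hf u uf.
have ltij := E_lt _ _ Eij.
have ji : j != i by apply: contraTneq ltij => ->; rewrite ltnn.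
(* Since [pi (r - 1) < n], every index below r is sent below n, and the default 0 of [inc_act] does
   not occur. *)
have pi_lt (l : 'I_r) : (pi l < n)%N.
  by have := ltn_ord l; have := @Inc_gap pi l r.-1 Ipi; lia.
rewrite /mmap1 (bigD1 i) //= (bigD1 j) //=.
rewrite (insubT (fun m => m < n)%N (pi_lt i)) (insubT (fun m => m < n)%N (pi_lt j)).
move: (u i) ui (u j) uj => [//|a] _ [//|b] _.
rewrite !exprS.
set x := 'X_ _; set y := 'X_ _; set z := \prod_(_ < r | _) _.
have -> : (f@_u)%:MP * (x * x ^+ a * (y * y ^+ b * z)) =
    (f@_u)%:MP * x ^+ a * y ^+ b * z * (x * y) by ring.
apply: monomial_idealM; first exact: edge_monomialD.
move=> v; rewrite -mpolyXD msuppX inE => /eqP ->.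
exists (Ordinal (pi_lt i)), (Ordinal (pi_lt j)); rewrite !mnmDE !mnm1E !eqxx addn1.
split=> //; apply/shifted_edgeP; exists i, j => /=.
have := Inc_ge i Ipi; have := Inc_gap Ipi (ltnW ltij).
(* The last condition compares j with r - 1: [pi j + (r - 1) <= pi (r - 1) + j < n + j]. *)
by have := @Inc_gap pi j r.-1 Ipi; have := ltn_ord j; split=> //; lia.
Qed.

(* The witness shifts [i, .., j - 1] by [a - i] and everything from [j] on by [b - j]. *)
Lemma shifted_edge_Inc n (E : rel 'I_r) (a b : 'I_n) :
  (forall i j, E i j -> (i < j)%N) -> shifted_edge E a b ->
  exists pi (i j : 'I_r),
    [/\ Inc_mn r n pi, E i j &
        inc_act n pi ('X_i * 'X_j) = 'X_a * 'X_b :> {mpoly k[n]}].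
Proof.
move=> E_lt /shifted_edgeP[i [j [Eij ia jb bn]]].
have ltij := E_lt _ _ Eij; have ltj := ltn_ord j.
pose pi l := if (l < i)%N then l else if (l < j)%N then (l + (a - i))%N else (l + (b - j))%N.
have pi_i : pi i = a by rewrite /pi ltnn ltij subnKC.
(* The truncated [b - j] is exact: i <= a and j - i <= b - a give j <= b. *)
have pi_j : pi j = b by rewrite /pi ltnn ltnNge (ltnW ltij) /= subnKC //; lia.
exists pi, i, j; split=> //.
  split=> [x y|]; rewrite /pi; first by do !case: ifP; lia.
  by have := ltn_ord b; do !case: ifP; lia.
by rewrite /inc_act rmorphM /= !mmapX !mmap1U pi_i pi_j !valK.
Qed.

Lemma stable_edge_ideal (I : forall n, set {mpoly k[n]}) :
  is_edge_ideal (I r) -> stable_from I r ->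
  exists2 E : rel 'I_r, (forall i j, E i j -> (i < j)%N) &
    forall n, (r <= n)%N -> forall f,
      I n f <-> monomial_ideal (edge_monomial (@shifted_edge r n E) [set: 'I_n]) f.
Proof.
move=> /edge_ideal_monomial[E E_lt [IrE EIr]] stI.
exists E => // n le_rn f; rewrite stI //; split.
  apply: ideal_gen_min; [exact: monomial_ideal0|exact: monomial_idealD|].
  move=> a _ [pi [g [Ipi /IrE Irg ->]]]; apply: monomial_idealM; first exact: edge_monomialD.
  exact: inc_act_monomial.
move=> hf; rewrite (mpolyE f); apply: ideal_gen_sum => u /hf[a [b [_ _ eab ua ub]]].
have [pi [i [j [Ipi Eij piE]]]] := shifted_edge_Inc E_lt eab.
have ab : a != b by apply: contraTneq eab => ->; rewrite (shifted_edge_irr E_lt).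
(* After one factor x_a is taken out, x_b still divides the rest because a and b differ. *)
have ub' : (0 < (u - U_(a))%MM b)%N by rewrite mnmBE mnm1E (negPf ab) subn0.
rewrite (mnm_split ua) (mnm_split ub') -addmA [(U_(b) + _)%MM]addmC !mpolyXD scalerAl.
by apply: ideal_gen_mul; exists pi, ('X_i * 'X_j); split=> //; exact: EIr.
Qed.

End StableEdgeIdeals.

Theorem theorem6p1 (k : fieldType) (I : forall n : nat, set {mpoly k[n]})
    (r : nat)
    (I_edge : forall n : nat, (0 < n)%N -> is_edge_ideal (I n))
    (I_chain : Inc_invariant I)
    (I_nonzero : exists N : nat, forall n : nat,
       (N <= n)%N -> nonzero_ideal (I n))
    (r_ind : is_ind I r)
    (n : nat) (le_4r_n : (4 * r <= n)%N) :
  exists2 d : int, has_reg (I n) d & d <= 3.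
Proof.
have [r_gt0 stI _] := r_ind.
have edge_r := I_edge r r_gt0.
have le_rn : (r <= n)%N by lia.
have [E E_lt InE] := stable_edge_ideal r_gt0 edge_r stI.
apply: regular_has_reg.
  have h := regular_shifted k E_lt r_gt0 le_4r_n.
  by apply: regular_iff h => v; rewrite InE.
(* Nonvanishing is given only from N on. A nonzero member of a later ideal yields some pair (i, j)
   in [E], and its unshifted copy is an edge of I_n. *)
have [N /(_ (maxn N r) (leq_maxl _ _))[f If f0]] := I_nonzero.
case fE: (msupp f) => [|u s]; first by rewrite -msupp_eq0 fE in f0.
have uf : u \in msupp f by rewrite fE mem_head.
have [_ [_ [_ _ /shifted_edgeP[i [j [Eij _ _ _]]] _ _]]] := (InE _ (leq_maxr _ _) f).1 If u uf.
exists 'X_[U_(widen_ord le_rn i) + U_(widen_ord le_rn j)]; last by rewrite -msupp_eq0 msuppX.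
apply/InE => // v; rewrite msuppX inE => /eqP ->.
exists (widen_ord le_rn i), (widen_ord le_rn j).
rewrite !inE !mnmDE !mnm1E !eqxx addn1; split=> //.
by apply/shifted_edgeP; exists i, j => /=; split=> //; lia.
Qed.
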